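(* Let $\Lambda$ be a row-finite $k$-graph with no sources. If $\mathbb{Z}^k$ acts freely on every quotient $T_\Lambda/I$ of the talented monoid $T_\Lambda$ by a $\mathbb{Z}^k$-order ideal $I$, then $\Lambda$ is strongly aperiodic. The converse holds if $T_\Lambda$ is atomic.
   Context: **$k$-graphs.** $\mathbb{N}=\{0,1,2,\dots\}$, $k\ge 1$, $e_i$ is the $i$-th standard generator of $\mathbb{N}^k$; $\mathbb{N}^k$ is ordered coordinatewise, with $m\vee n$ the coordinatewise maximum. A $k$-graph is a countable small category $\Lambda$ with object set $\Lambda^0$ (identified with the identity morphisms), range and source maps $r,s:\Lambda\to\Lambda^0$, and a functor $d:\Lambda\to\mathbb{N}^k$ with the unique factorization property: if $d(\lambda)=m+n$ there are unique $\mu_1,\mu_2\in\Lambda$ with $\lambda=\mu_1\mu_2$, $d(\mu_1)=m$, $d(\mu_2)=n$ (the product $\mu_1\mu_2$ is defined iff $s(\mu_1)=r(\mu_2)$). For $v\in\Lambda^0$, $n\in\mathbb{N}^k$: $v\Lambda=r^{-1}(v)$ and $v\Lambda^n=\{\lambda\in v\Lambda: d(\lambda)=n\}$. $\Lambda$ is row-finite if every $v\Lambda^n$ is finite, and has no sources if every $v\Lambda^n$ is nonempty. **Talented monoid.** $T_\Lambda$ is the commutative monoid generated by symbols $v(n)$ ($v\in\Lambda^0$, $n\in\mathbb{Z}^k$) subject to $v(n)=\sum_{\alpha\in v\Lambda^{e_i}}s(\alpha)(n+e_i)$ for all $v$, $n$ and $i\in\{1,\dots,k\}$ with $v\Lambda^{e_i}\neq\emptyset$.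 $\mathbb{Z}^k$ acts on $T_\Lambda$ by monoid automorphisms determined by ${}^{n}v(m)=v(m+n)$. **Monoids.** In a commutative monoid $M$ put $x\le y$ iff $y=x+z$ for some $z\in M$. A unit is an element $u\le 0$; a nonunit $a$ is an atom if $a=b+c$ implies $b$ or $c$ is a unit; $M$ is atomic if every nonunit is a finite sum of atoms. If $\mathbb{Z}^k$ acts on $M$ by monoid automorphisms, a $\mathbb{Z}^k$-order ideal is a submonoid $I$ that is closed under the action and such that $x\le y\in I$ implies $x\in I$. The quotient $M/I$ is $M/\!\equiv_I$, where $x\equiv_I y$ iff $x+a=y+b$ for some $a,b\in I$; it inherits the $\mathbb{Z}^k$-action. $\mathbb{Z}^k$ acts freely on a monoid if no nonzero element $a$ satisfies ${}^{n}a=a$ for some $0\neq n\in\mathbb{Z}^k$. **Aperiodicity.** For $0\le m\le n\le d(\lambda)$, $\lambda(m,n)$ denotes the unique path $\mu_2$ with $\lambda=\mu_1\mu_2\mu_3$, $d(\mu_1)=m$, $d(\mu_2)=n-m$. $\mathrm{MCE}(\lambda,\mu)$ is the set of $\tau\in\Lambda$ with $d(\tau)=d(\lambda)\vee d(\mu)$, $\tau(0,d(\lambda))=\lambda$, $\tau(0,d(\mu))=\mu$. A row-finite $k$-graph $\Lambda$ is aperiodic if for every pair of distinct paths $\alpha,\beta\in\Lambda$ with $s(\alpha)=s(\beta)$ there is $\tau\in s(\alpha)\Lambda$ with $\mathrm{MCE}(\alpha\tau,\beta\tau)=\emptyset$. A subset $H\subseteq\Lambda^0$ is hereditary if $r(\lambda)\in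 H$ implies $s(\lambda)\in H$ for $\lambda\in\Lambda$; it is saturated if for $v\in\Lambda^0$, $n\in\mathbb{N}^k$, $s(v\Lambda^n)\subseteq H$ implies $v\in H$. For hereditary saturated $H$, $\Lambda/H$ is the $k$-graph with morphisms $\{\lambda\in\Lambda: s(\lambda)\notin H\}$, objects $\Lambda^0\setminus H$, and structure restricted from $\Lambda$. $\Lambda$ is strongly aperiodic if $\Lambda/H$ is aperiodic for every proper hereditary saturated subset $H\subsetneq\Lambda^0$. *)

(* Defs.v *)
From HB Require Import structures.
From mathcomp Require Import all_boot all_order all_algebra finmap multiset.
From mathcomp Require Import boolp classical_sets functions cardinality fsbigop.

Set Implicit Arguments.
Unset Strict Implicit.
Unset Printing Implicit Defensive.

Import GRing.Theory.

Local Open Scope mset_scope.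
Local Open Scope classical_set_scope.
Local Open Scope quotient_scope.
Local Open Scope ring_scope.

Section Monoids.
Implicit Type M : nmodType.

Definition mle M (x y : M) : Prop := exists z, y = x + z.

Definition munit M (u : M) : Prop := mle u 0.

Definition matom M (a : M) : Prop :=
  ~ munit a /\ forall b c, a = b + c -> munit b \/ munit c.

Definition atomic M : Prop :=
  forall a : M, ~ munit a ->
    exists2 s : seq M, (forall x, x \in s -> matom x) & a = \sum_(x <- s) x.

Record zaction (k : nat) M := ZAction {
  zact :> 'rV[int]_k -> M -> M;
  zact0 : forall x, zact 0 x = x;
  zactD : forall m n x, zact (m + n) x = zact m (zact n x);
  zact_zero : forall n, zact n 0 = 0;
  zact_add : forall n x y, zact n (x + y) = zact n x + zact n y
}.

Definition acts_freely k M (A : zaction k M) : Prop :=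
  forall (a : M) (n : 'rV[int]_k), a != 0 -> n != 0 -> A n a != a.

Record zorder_ideal k M (A : zaction k M) (I : set M) : Prop := ZOrderIdeal {
  ideal_zero : I 0;
  ideal_add : forall x y, I x -> I y -> I (x + y);
  ideal_act : forall n x, I x -> I (A n x);
  ideal_le : forall x y, mle x y -> I y -> I x
}.

Record congruence M := Congruence {
  cong :> M -> M -> Prop;
  cong_refl : forall x, cong x x;
  cong_sym : forall x y, cong x y -> cong y x;
  cong_trans : forall x y z, cong x y -> cong y z -> cong x z;
  cong_add : forall x x' y y', cong x x' -> cong y y' -> cong (x + y) (x' + y')
}.

Inductive gen_cong M (R : M -> M -> Prop) : M -> M -> Prop :=
| GenRel x y : R x y -> gen_cong R x y
| GenRefl x : gen_cong R x x
| GenSym x y : gen_cong R x y -> gen_cong R y x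
| GenTrans x y z : gen_cong R x y -> gen_cong R y z -> gen_cong R x z
| GenAdd x x' y y' :
    gen_cong R x x' -> gen_cong R y y' -> gen_cong R (x + y) (x' + y').

Definition generated_congruence M (R : M -> M -> Prop) : congruence M :=
  Congruence (@GenRefl M R) (@GenSym M R) (@GenTrans M R) (@GenAdd M R).

End Monoids.

Section QuotientMonoid.
Variables (M : nmodType) (c : congruence M).

Definition cong_bool : rel M := fun x y => `[< c x y >].

Lemma cong_bool_refl : reflexive cong_bool.
Proof. by move=> x; apply/asboolP; exact: cong_refl. Qed.

Lemma cong_bool_sym : symmetric cong_bool.
Proof. by move=> x y; apply/asboolP/asboolP; exact: cong_sym. Qed.

Lemma cong_bool_trans : transitive cong_bool.
Proof.
by move=> y x z /asboolP xy /asboolP yz; apply/asboolP; exact: cong_trans yz.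
Qed.

Canonical cong_equiv := EquivRel cong_bool
  cong_bool_refl cong_bool_sym cong_bool_trans.

Definition mquot : Type := {eq_quot cong_equiv}.

HB.instance Definition _ := Choice.on mquot.
HB.instance Definition _ := EqQuotient.on mquot.

Lemma mquot_eqP (x y : M) : \pi_mquot x = \pi_mquot y <-> c x y.
Proof. by split=> [/eqquotP/asboolP//|xy]; apply/eqquotP/asboolP. Qed.

Lemma mquot_repr (x : M) : c (repr (\pi_mquot x)) x.
Proof. by apply/mquot_eqP; rewrite reprK. Qed.

Definition mquot_add (a b : mquot) : mquot := \pi_mquot (repr a + repr b).

Lemma mquot_addE x y :
  mquot_add (\pi_mquot x) (\pi_mquot y) = \pi_mquot (x + y).
Proof. by apply/mquot_eqP; apply: cong_add; exact: mquot_repr. Qed.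

Lemma mquot_addA : associative mquot_add.
Proof.
elim/quotW=> a; elim/quotW=> b; elim/quotW=> d.
by rewrite (mquot_addE b d) (mquot_addE a b) (mquot_addE a) (mquot_addE _ d) addrA.
Qed.

Lemma mquot_addC : commutative mquot_add.
Proof. by move=> a b; rewrite /mquot_add addrC. Qed.

Lemma mquot_add0 : left_id (\pi_mquot 0) mquot_add.
Proof. by elim/quotW=> a; rewrite (mquot_addE 0 a) add0r. Qed.

HB.instance Definition _ :=
  GRing.isNmodule.Build mquot mquot_addA mquot_addC mquot_add0.

Lemma mquot_piD (x y : M) : \pi_mquot (x + y) = \pi_mquot x + \pi_mquot y.
Proof. by rewrite -mquot_addE. Qed.

Lemma mquot_pi0 : \pi_mquot 0 = 0.
Proof. by []. Qed.

Section QuotientAction.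
Variables (k : nat) (A : zaction k M).
Hypothesis cA : forall n x y, c x y -> c (A n x) (A n y).

Definition mquot_act (n : 'rV[int]_k) (a : mquot) : mquot :=
  \pi_mquot (A n (repr a)).

Lemma mquot_actE n x : mquot_act n (\pi_mquot x) = \pi_mquot (A n x).
Proof. by apply/mquot_eqP; apply: cA; exact: mquot_repr. Qed.

Lemma mquot_act0 a : mquot_act 0 a = a.
Proof. by rewrite /mquot_act zact0 reprK. Qed.

Lemma mquot_actD m n a : mquot_act (m + n) a = mquot_act m (mquot_act n a).
Proof.
by elim/quotW: a => a; rewrite (mquot_actE n a) (mquot_actE m) mquot_actE zactD.
Qed.

Lemma mquot_act_zero n : mquot_act n 0 = 0.
Proof. by rewrite -mquot_pi0 mquot_actE zact_zero. Qed.

Lemma mquot_act_add n a b :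
  mquot_act n (a + b) = mquot_act n a + mquot_act n b.
Proof.
elim/quotW: a => a; elim/quotW: b => b.
by rewrite -mquot_piD !mquot_actE zact_add mquot_piD.
Qed.

Definition mquot_zaction : zaction k mquot :=
  ZAction mquot_act0 mquot_actD mquot_act_zero mquot_act_add.

End QuotientAction.
End QuotientMonoid.

Section IdealQuotient.
Variables (k : nat) (M : nmodType) (A : zaction k M) (I : set M).
Hypothesis hI : zorder_ideal A I.

Definition ideal_cong (x y : M) : Prop :=
  exists a b, [/\ I a, I b & x + a = y + b].

Lemma ideal_cong_refl x : ideal_cong x x.
Proof. by exists 0, 0; split=> //; exact: ideal_zero hI. Qed.

Lemma ideal_cong_sym x y : ideal_cong x y -> ideal_cong y x.
Proof. by case=> a [b [Ia Ib e]]; exists b, a. Qed.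

Lemma ideal_cong_trans x y z :
  ideal_cong x y -> ideal_cong y z -> ideal_cong x z.
Proof.
case=> a [b [Ia Ib e]] [a' [b' [Ia' Ib' e']]]; exists (a + a'), (b' + b).
split; [exact: (ideal_add hI)|exact: (ideal_add hI)|].
by rewrite addrA e addrAC e' addrA.
Qed.

Lemma ideal_cong_add x x' y y' :
  ideal_cong x x' -> ideal_cong y y' -> ideal_cong (x + y) (x' + y').
Proof.
case=> a [b [Ia Ib e]] [a' [b' [Ia' Ib' e']]]; exists (a + a'), (b + b').
split; [exact: (ideal_add hI)|exact: (ideal_add hI)|].
by rewrite addrACA e e' addrACA.
Qed.

Definition ideal_congruence : congruence M :=
  Congruence ideal_cong_refl ideal_cong_sym ideal_cong_trans ideal_cong_add.

Lemma ideal_cong_act n x y :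
  ideal_congruence x y -> ideal_congruence (A n x) (A n y).
Proof.
case=> a [b [Ia Ib e]]; exists (A n a), (A n b).
by split; [exact: (ideal_act hI)|exact: (ideal_act hI)|rewrite -!zact_add e].
Qed.

Definition ideal_quotient : nmodType := mquot ideal_congruence.

Definition ideal_quotient_action : zaction k ideal_quotient :=
  mquot_zaction ideal_cong_act.

End IdealQuotient.

(* [{mset K}] is the free commutative monoid on K, with generators
   [[mset x]]. *)
HB.instance Definition _ (K : choiceType) :=
  Choice.copy {mset K} {fsfun K -> nat with 0%N}.

HB.instance Definition _ (K : choiceType) :=
  GRing.isNmodule.Build {mset K} (@msetDA K) (@msetDC K) (@mset0D K).

Section FreeMonoid.
Variable K : choiceType.

Lemma mset_addE (A B : {mset K}) x : (A + B) x = (A x + B x)%N.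
Proof. by rewrite [A + B]/(msetD A B) msetE2. Qed.

Definition mset_map (f : K -> K) (A : {mset K}) : {mset K} :=
  seq_mset [seq f x | x <- A].

Lemma mset_map0 f : mset_map f 0 = 0.
Proof.
by rewrite /mset_map enum_mset0; apply/msetP=> x; rewrite mset_seqE mset0E.
Qed.

Lemma mset_mapD f (A B : {mset K}) : mset_map f (A + B) = mset_map f A + mset_map f B.
Proof.
have AB : perm_eq (A + B : {mset K}) (A ++ B).
  by apply/allP=> x _ /=; rewrite count_cat !count_mem_mset mset_addE.
apply/msetP=> y; rewrite mset_addE !mset_seqE -count_cat -map_cat.
exact: (seq.permP (perm_map f AB) (pred1 y)).
Qed.

Lemma mset_map_id f A : f =1 id -> mset_map f A = A.
Proof. by move=> fE; rewrite /mset_map (eq_map fE) map_id seq_mset_id. Qed.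

Lemma mset_map_comp f g A :
  mset_map (f \o g) A = mset_map f (mset_map g A).
Proof.
apply/eq_seq_msetP; rewrite (map_comp f g); apply: perm_map.
by rewrite perm_sym perm_eq_seq_mset.
Qed.

Lemma mset_map1 f x : mset_map f [mset x] = [mset f x].
Proof.
rewrite /mset_map enum_msetn; apply/msetP=> y.
by rewrite mset_seqE msetnE /= addn0 eq_sym; case: eqP.
Qed.

End FreeMonoid.


(* Composition [kcomp a b] is total; its value is only meaningful when
   [ksrc a = krng b]. *)
Record kgraph (k : nat) := KGraph {
  kvertex : countType;
  kpath : countType;
  krng : kpath -> kvertex;
  ksrc : kpath -> kvertex;
  kid : kvertex -> kpath;
  kcomp : kpath -> kpath -> kpath;
  kdeg : kpath -> 'rV[nat]_k;
  krng_id : forall v, krng (kid v) = v;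
  ksrc_id : forall v, ksrc (kid v) = v;
  krng_comp : forall a b, ksrc a = krng b -> krng (kcomp a b) = krng a;
  ksrc_comp : forall a b, ksrc a = krng b -> ksrc (kcomp a b) = ksrc b;
  kcomp_idl : forall a, kcomp (kid (krng a)) a = a;
  kcomp_idr : forall a, kcomp a (kid (ksrc a)) = a;
  kcompA : forall a b c, ksrc a = krng b -> ksrc b = krng c ->
    kcomp a (kcomp b c) = kcomp (kcomp a b) c;
  kdeg_id : forall v, kdeg (kid v) = 0;
  kdeg_comp : forall a b, ksrc a = krng b ->
    kdeg (kcomp a b) = kdeg a + kdeg b;
  kfactor : forall l m n, kdeg l = m + n ->
    exists! p : kpath * kpath,
      [/\ ksrc p.1 = krng p.2, l = kcomp p.1 p.2, kdeg p.1 = m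
        & kdeg p.2 = n]
}.

Section KGraphs.
Variable k : nat.
Implicit Type L : kgraph k.

Definition paths_from L (v : kvertex L) (n : 'rV[nat]_k) : set (kpath L) :=
  [set l | krng l = v /\ kdeg l = n].

Definition row_finite L : Prop :=
  forall (v : kvertex L) n, finite_set (paths_from v n).

Definition no_sources L : Prop :=
  forall (v : kvertex L) n, paths_from v n !=set0.

(* [segment l m n u] is the graph of the partial function (m, n) |-> l(m, n):
   it says that u = l(m, n), and forces m <= n <= d(l). *)
Definition segment L (l : kpath L) (m n : 'rV[nat]_k) (u : kpath L) : Prop :=
  exists a b, [/\ ksrc a = krng u, ksrc u = krng b,
    l = kcomp (kcomp a u) b, kdeg a = m & m + kdeg u = n].

Definition MCE L (a b : kpath L) : set (kpath L) :=
  [set t | [/\ kdeg t = map2_mx maxn (kdeg a) (kdeg b),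
     segment t 0 (kdeg a) a & segment t 0 (kdeg b) b]].

Definition aperiodic L : Prop :=
  forall a b : kpath L, a <> b -> ksrc a = ksrc b ->
    exists2 t, krng t = ksrc a & MCE (kcomp a t) (kcomp b t) = set0.

Definition hereditary L (H : set (kvertex L)) : Prop :=
  forall l : kpath L, H (krng l) -> H (ksrc l).

Definition saturated L (H : set (kvertex L)) : Prop :=
  forall v n, @ksrc _ L @` paths_from v n `<=` H -> H v.

End KGraphs.

Section QuotientGraph.
Variables (k : nat) (L : kgraph k) (H : set (kvertex L)).
Hypothesis hH : hereditary H.

Definition qvertex : countType := {v : kvertex L | v \notin H}.
Definition qpath : countType := {l : kpath L | ksrc l \notin H}.

Lemma qrng_subproof (l : qpath) : krng (val l) \notin H.
Proof.
by apply: contra (valP l); rewrite !in_setE; exact: hH.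
Qed.

Lemma qid_subproof (v : qvertex) : ksrc (kid (val v)) \notin H.
Proof. by rewrite ksrc_id; exact: (valP v). Qed.

Definition qrng (l : qpath) : qvertex := Sub (krng (val l)) (qrng_subproof l).
Definition qsrc (l : qpath) : qvertex := Sub (ksrc (val l)) (valP l).
Definition qid (v : qvertex) : qpath := Sub (kid (val v)) (qid_subproof v).
(* The default of [insubd] is not used on composable pairs. *)
Definition qcomp (a b : qpath) : qpath := insubd a (kcomp (val a) (val b)).
Definition qdeg (l : qpath) : 'rV[nat]_k := kdeg (val l).

Lemma qcomposable a b : qsrc a = qrng b <-> ksrc (val a) = krng (val b).
Proof. by split=> [/(congr1 val)|e] //; apply: val_inj. Qed.

Lemma val_qcomp a b : qsrc a = qrng b ->
  val (qcomp a b) = kcomp (val a) (val b).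
Proof.
by move=> /qcomposable ab; rewrite insubdK // unfold_in ksrc_comp //; exact: (valP b).
Qed.

Lemma qrng_id v : qrng (qid v) = v.
Proof. by apply: val_inj; rewrite /= krng_id. Qed.

Lemma qsrc_id v : qsrc (qid v) = v.
Proof. by apply: val_inj; rewrite /= ksrc_id. Qed.

Lemma qrng_comp a b : qsrc a = qrng b -> qrng (qcomp a b) = qrng a.
Proof.
move=> ab; apply: val_inj; rewrite [LHS]/= val_qcomp //.
by apply: krng_comp; apply/qcomposable.
Qed.

Lemma qsrc_comp a b : qsrc a = qrng b -> qsrc (qcomp a b) = qsrc b.
Proof.
move=> ab; apply: val_inj; rewrite [LHS]/= val_qcomp //.
by apply: ksrc_comp; apply/qcomposable.
Qed.

Lemma qcomp_idl a : qcomp (qid (qrng a)) a = a.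
Proof. by apply: val_inj; rewrite val_qcomp ?qsrc_id //= kcomp_idl. Qed.

Lemma qcomp_idr a : qcomp a (qid (qsrc a)) = a.
Proof. by apply: val_inj; rewrite val_qcomp ?qrng_id //= kcomp_idr. Qed.

Lemma qcompA a b c : qsrc a = qrng b -> qsrc b = qrng c ->
  qcomp a (qcomp b c) = qcomp (qcomp a b) c.
Proof.
move=> ab bc; apply: val_inj; rewrite !val_qcomp ?qrng_comp ?qsrc_comp //.
by apply: kcompA; apply/qcomposable.
Qed.

Lemma qdeg_id v : qdeg (qid v) = 0.
Proof. exact: kdeg_id. Qed.

Lemma qdeg_comp a b : qsrc a = qrng b -> qdeg (qcomp a b) = qdeg a + qdeg b.
Proof.
by move=> ab; rewrite /qdeg val_qcomp //; apply: kdeg_comp; apply/qcomposable.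
Qed.

Lemma qfactor l m n : qdeg l = m + n ->
  exists! p : qpath * qpath,
    [/\ qsrc p.1 = qrng p.2, l = qcomp p.1 p.2, qdeg p.1 = m & qdeg p.2 = n].
Proof.
move=> /kfactor[[a b] [/= [ab lE am bn] uniqE]].
have bH : ksrc b \notin H by have := valP l; rewrite -(ksrc_comp ab) -lE.
have aH : ksrc a \notin H by rewrite ab; exact: (qrng_subproof (Sub b bH)).
exists (Sub a aH : qpath, Sub b bH : qpath); split=> [|[a' b'] /= [ab' lE' am' bn']].
  split=> //; first exact/qcomposable.
  by apply: val_inj; rewrite val_qcomp //; apply/qcomposable.
have [aE bE] : (a, b) = (val a', val b').
  apply: uniqE; split=> //; first exact/qcomposable.
  by rewrite lE' val_qcomp.
by congr pair; apply: val_inj.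
Qed.

Definition quotient_graph : kgraph k :=
  KGraph qrng_id qsrc_id qrng_comp qsrc_comp qcomp_idl qcomp_idr qcompA
    qdeg_id qdeg_comp qfactor.

End QuotientGraph.

Definition strongly_aperiodic k (L : kgraph k) : Prop :=
  forall (H : set (kvertex L)) (hH : hereditary H),
    saturated H -> H <> setT -> aperiodic (quotient_graph hH).

Section TalentedMonoid.
Variables (k : nat) (L : kgraph k).

Definition talented_symbol : choiceType := (kvertex L * 'rV[int]_k)%type.

Definition symbol (v : kvertex L) (n : 'rV[int]_k) : {mset talented_symbol} :=
  [mset ((v, n) : talented_symbol)].

(* The sum is over a finite set when L is row-finite, and no summand is 0. *)
Inductive talented_rel : {mset talented_symbol} -> {mset talented_symbol} -> Prop :=
| TalentedRel v n (i : 'I_k) : paths_from v (delta_mx 0 i) !=set0 ->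
    talented_rel (symbol v n)
      (\sum_(a \in paths_from v (delta_mx 0 i))
         symbol (ksrc a) (n + delta_mx 0 i)).

Definition talented_congruence : congruence {mset talented_symbol} :=
  generated_congruence talented_rel.

Definition talented : nmodType := mquot talented_congruence.

Definition symbol_shift (n : 'rV[int]_k) (x : talented_symbol) :
  talented_symbol := (x.1, x.2 + n).

Lemma mset_shift0 A : mset_map (symbol_shift 0) A = A.
Proof. by apply: mset_map_id => -[v m]; rewrite /symbol_shift /= addr0. Qed.

Lemma mset_shiftD m n A :
  mset_map (symbol_shift (m + n)) A =
  mset_map (symbol_shift m) (mset_map (symbol_shift n) A).
Proof.
rewrite -mset_map_comp; congr mset_map; apply/funext=> -[v p].
by rewrite /symbol_shift /= -addrA (addrC n).
Qed.

Definition free_action : zaction k {mset talented_symbol} :=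
  ZAction mset_shift0 mset_shiftD
    (fun n => mset_map0 (symbol_shift n))
    (fun n => mset_mapD (symbol_shift n)).

Lemma free_action_symbol n v m : free_action n (symbol v m) = symbol v (m + n).
Proof. exact: mset_map1. Qed.

Lemma symbol_neq0 v n : symbol v n <> 0.
Proof. by move=> /msetP/(_ (v, n)); rewrite msetnxx mset0E. Qed.

Lemma free_action_cong n x y :
  talented_congruence x y -> talented_congruence (free_action n x) (free_action n y).
Proof.
elim=> {x y} [_ _ [v m i hv]|x|x y _ IH|x y z _ xy _ yz|x x' y y' _ xx' _ yy'].
- have morph : {morph free_action n : a b / a + b}.
    by move=> a b; exact: zact_add.
  have eqs (p : 'rV[int]_k) (F : kpath L -> {mset talented_symbol}) :
      (forall a, F a <> 0) ->
      finite_support 0 (paths_from v (delta_mx 0 i)) F =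
      finite_support 0 (paths_from v (delta_mx 0 i)) (fun a => symbol (ksrc a) p).
    move=> F0; rewrite /finite_support; congr (locked_with _ (fset_set _)).
    apply/seteqP; split=> a [va _]; split=> //; [exact: symbol_neq0|exact: F0].
  rewrite (big_morph _ morph (zact_zero free_action n)) free_action_symbol.
  under eq_bigr do rewrite free_action_symbol addrAC.
  rewrite (eqs (m + n + delta_mx 0 i)); last by move=> a; exact: symbol_neq0.
  by apply: GenRel; constructor.
- exact: GenRefl.
- exact: GenSym.
- exact: GenTrans xy yz.
- by rewrite !zact_add; exact: GenAdd.
Qed.

Definition talented_action : zaction k talented :=
  mquot_zaction free_action_cong.

Definition talented_gen (v : kvertex L) (n : 'rV[int]_k) : talented :=
  \pi_talented (symbol v n).

Lemma talented_action_gen n v m :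
  talented_action n (talented_gen v m) = talented_gen v (m + n).
Proof. by rewrite /talented_gen -free_action_symbol; exact: (mquot_actE free_action_cong). Qed.

End TalentedMonoid.

(* Main.v *)
Require Import Defs.
From mathcomp Require Import all_boot all_order all_algebra finmap multiset.
From mathcomp Require Import boolp classical_sets cardinality fsbigop.
From mathcomp Require Import zify.

Set Implicit Arguments.
Unset Strict Implicit.
Unset Printing Implicit Defensive.

Import GRing.Theory.

Local Open Scope mset_scope.
Local Open Scope quotient_scope.
Local Open Scope ring_scope.

(** Write [T] for the talented monoid of [L]. Following a vertex along all of
    its paths of degree [m] gives [v(N) = \sum_a s(a)(N + m)] in [T], the sum
    being over the paths [a] of degree [m] with range [v]
    ([talented_gen_expand]).

    Free actions imply strong aperiodicity. Let [H] be hereditary and saturated.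
    The sums of symbols over vertices of [H] form an order ideal [I_H] of [T],
    and [v(N)] lies in [I_H] only if [v] lies in [H] ([vertex_idealP],
    [vertex_ideal_gen]). Suppose that [L/H] is not aperiodic, so that there are
    distinct paths [a] and [b] in it with the same source [w] that no extension
    separates, and let [N] be the join of their degrees. Then the extensions of
    [a] of degree [N] inside [L/H] are the extensions of [b] of degree [N]
    ([MCE_swap]). Expanding [w(d(a))] and [w(d(b))] to level [N] and discarding
    the terms over [H] gives the same sum for both, so that [w(d(a)) = w(d(b))]
    in [T/I_H], while [d(a) <> d(b)] and [w] is not in [H]. The action on
    [T/I_H] is therefore not free ([free_aperiodic]).

    Conversely, [T] is a direct limit of free commutative monoids: two sums of
    symbols are equal in [T] if and only if expanding them to all high enough
    levels gives equal multisets ([push_cong], [push_pi]). It follows that the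
    atoms of [T] are prime ([atom_prime]), that each atom is some [v(N)]
    ([atom_gen]) and that [v] then emits a single path of each degree
    ([atom_path_enum]). Let [T] be atomic and let [n <> 0] fix a nonzero class
    of [T/I]. Write a representative as a sum of atoms. By primeness, translation
    by [-n] maps the finite set of those summands outside [I] into itself, so that
    some nonzero multiple of [n] fixes one of them, say [v(N)] ([aperiodic_free]).
    Comparing [v(N)] with its translate at a common level gives two paths with
    range [v], equal sources and different degrees ([atom_period]). The vertices
    whose symbols lie in [I] form a hereditary saturated set; outside of it, both
    paths survive and, [v] emitting one path of each degree, no extension
    separates them. So [L] is not strongly aperiodic
    ([atom_outside_not_periodic]). *)

(** * Degrees *)

Section Degrees.
Variable k : nat.
Implicit Types (m n p q : 'rV[nat]_k) (N : 'rV[int]_k).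

(** The inclusion of N^k into Z^k. *)
Definition degz n : 'rV[int]_k := map_mx Posz n.

(** The coordinatewise absolute value, a left inverse of [degz]. *)
Definition absd N : 'rV[nat]_k := map_mx absz N.

Lemma degzK : cancel degz absd.
Proof. by move=> n; apply/rowP=> j; rewrite !mxE. Qed.

Lemma degz0 : degz 0 = 0.
Proof. by apply/rowP=> j; rewrite !mxE. Qed.

Lemma degzD : {morph degz : m n / m + n}.
Proof. by move=> m n; apply/rowP=> j; rewrite !mxE PoszD. Qed.

Lemma degz_delta i : degz (delta_mx 0 i) = delta_mx 0 i.
Proof. by apply/rowP=> j; rewrite !mxE; case: (_ && _). Qed.

Lemma degree_ind (P : 'rV[nat]_k -> Prop) :
  P 0 -> (forall m n, P m -> P n -> P (m + n)) ->
  (forall i, P (delta_mx 0 i)) -> forall n, P n.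
Proof.
move=> P0 PD Pi n.
have -> : n = \sum_i delta_mx 0 i *+ n 0 i.
  apply/rowP=> j; rewrite summxE (bigD1 j) //= big1 ?addr0 => [|i ij].
    by rewrite mulmxnE mxE !eqxx !natn.
  by rewrite mulmxnE mxE (negPf (_ : j != i)) ?andbF ?mul0rn // eq_sym.
apply: (big_ind P) => // i _; elim: (n 0 i) => [|d IH]; first by rewrite mulr0n.
by rewrite mulrS; exact: PD.
Qed.

(** The join [m \/ n] in N^k. *)
Definition degmax m n : 'rV[nat]_k := map2_mx maxn m n.


(** Coordinatewise truncated subtraction. *)
Definition degsub m n : 'rV[nat]_k := map2_mx subn m n.

Lemma degmax_subl m n : m + degsub (degmax m n) m = degmax m n.
Proof. by apply/rowP=> j; rewrite !mxE; apply: subnKC; exact: leq_maxl. Qed.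

Lemma degmax_subr m n : n + degsub (degmax m n) n = degmax m n.
Proof. by apply/rowP=> j; rewrite !mxE; apply: subnKC; exact: leq_maxr. Qed.

Lemma degmaxC m n : degmax m n = degmax n m.
Proof. by apply/rowP=> j; rewrite !mxE; exact: maxnC. Qed.

Lemma degaddI m : injective (fun n => m + n).
Proof.
move=> n p /rowP mnp; apply/rowP=> j.
by have := mnp j; rewrite !mxE => /addnI.
Qed.

(** [P N] holds for all sufficiently large levels. *)
Definition eventually (P : 'rV[int]_k -> Prop) : Prop :=
  exists N0, forall p, P (N0 + degz p).

Lemma eventuallyT (P : 'rV[int]_k -> Prop) : (forall N, P N) -> eventually P.
Proof. by move=> PN; exists 0. Qed.

Lemma eventually_imp (P Q : 'rV[int]_k -> Prop) :
  (forall N, P N -> Q N) -> eventually P -> eventually Q.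
Proof. by move=> PQ [N0 PN0]; exists N0 => p; exact/PQ. Qed.

Lemma eventually_and (P Q : 'rV[int]_k -> Prop) :
  eventually P -> eventually Q -> eventually (fun N => P N /\ Q N).
Proof.
move=> [N0 PN0] [N1 QN1]; exists (N0 + degz (absd (N1 - N0))) => p.
split; first by rewrite -addrA -degzD.
have <- : N1 + degz (absd (N0 + degz (absd (N1 - N0)) - N1) + p)
    = N0 + degz (absd (N1 - N0)) + degz p.
    have absE (x y : int) : 
      y + absz (x + absz (y - x)%R - y)%R = x + absz (y - x)%R by lia.
  by rewrite degzD addrA; apply/rowP=> j; rewrite !mxE absE.
exact: QN1.
Qed.

Lemma eventually_ge N0 : eventually (fun N => exists p, N = N0 + degz p).
Proof. by exists N0 => p; exists p. Qed.

Lemma eventually_ex (P : 'rV[int]_k -> Prop) : eventually P -> exists N, P N.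
Proof. by move=> [N0 PN0]; exists (N0 + degz 0). Qed.

End Degrees.

(** * Paths of a k-graph *)

Section Paths.
Variables (k : nat) (L : kgraph k).
Implicit Types (a b l : kpath L) (v w : kvertex L) (m n p : 'rV[nat]_k).

Lemma kfactor_ex l m n : kdeg l = m + n -> exists a b,
  [/\ ksrc a = krng b, l = kcomp a b, kdeg a = m & kdeg b = n].
Proof. by case/kfactor=> -[a b] [ab _]; exists a, b. Qed.

Lemma kcomp_inj a b a' b' : ksrc a = krng b -> ksrc a' = krng b' ->
  kdeg a = kdeg a' -> kcomp a b = kcomp a' b' -> a = a' /\ b = b'.
Proof.
move=> ab ab' daa' e.
have dl := kdeg_comp ab.
have dbb' : kdeg b = kdeg b'.
  apply: (@degaddI _ (kdeg a)); rewrite -kdeg_comp // daa' -kdeg_comp //.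
  by rewrite e.
have [[x y] [_ uxy]] := kfactor dl.
have := uxy (a, b) (And4 ab erefl erefl erefl).
by rewrite (uxy (a', b') (And4 ab' e (esym daa') (esym dbb'))) => -[].
Qed.

Lemma kdeg0_id a : kdeg a = 0 -> a = kid (krng a).
Proof.
move=> da.
have [] := @kcomp_inj (kid (krng a)) a a (kid (ksrc a)).
- by rewrite ksrc_id.
- by rewrite krng_id.
- by rewrite kdeg_id.
- by rewrite kcomp_idl kcomp_idr.
- by [].
Qed.

Lemma segment0P l a : segment l 0 (kdeg a) a <->
  exists2 b, ksrc a = krng b & l = kcomp a b.
Proof.
split=> [[c [b [ca ab -> dc _]]]|[b ab ->]].
  by exists b => //; rewrite (kdeg0_id dc) (_ : krng c = krng a) ?kcomp_idl //
    -ca (kdeg0_id dc) ksrc_id krng_id.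
exists (kid (krng a)), b; split=> //.
- by rewrite ksrc_id.
- by rewrite kcomp_idl.
- by rewrite kdeg_id.
- by rewrite add0r.
Qed.

Lemma MCE_prefixes a b t : MCE a b t ->
  (exists2 a', ksrc a = krng a' & t = kcomp a a') /\
  (exists2 b', ksrc b = krng b' & t = kcomp b b').
Proof. by move=> [_ /segment0P ta /segment0P tb]. Qed.

Lemma MCE_eq a b t : MCE a b t -> kdeg a = kdeg b -> a = b.
Proof.
move=> /MCE_prefixes[[a' aa' ->] [b' bb' e]] dab.
by have [] := kcomp_inj aa' bb' dab e.
Qed.

Lemma MCE_sym a b t : MCE a b t -> MCE b a t.
Proof. by move=> [dt ta tb]; split; rewrite // dt; exact: degmaxC. Qed.

(** If no extension separates [a] and [b], then each extension of [a] to the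
    degree [degmax (kdeg a) (kdeg b)] is also an extension of [b]. *)
Lemma MCE_swap (hns : no_sources L) a b :
  ksrc a = ksrc b ->
  (forall t, krng t = ksrc a -> (MCE (kcomp a t) (kcomp b t) !=set0)%classic) ->
  forall t, krng t = ksrc a -> kdeg t = degsub (degmax (kdeg a) (kdeg b)) (kdeg a) ->
  exists t', [/\ krng t' = ksrc b,
    kdeg t' = degsub (degmax (kdeg a) (kdeg b)) (kdeg b)
    & kcomp a t = kcomp b t'].
Proof.
move=> sab hM t ta dt; set N := degmax _ _ in dt *.
(* [t] is prolonged to a path whose composite with [b] has degree at least [N]. *)
have [u [ru du]] := hns (ksrc t) (degsub N (kdeg b)).
have tu : ksrc t = krng u by [].
have dtu : kdeg (kcomp t u) = degsub N (kdeg b) + kdeg t.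
  by rewrite kdeg_comp // du addrC.
have [t' [z [tz tuE dt' dz]]] := kfactor_ex dtu.
have rt' : krng t' = ksrc a.
  by rewrite -(krng_comp tz) -tuE krng_comp.
have [s /MCE_prefixes[[a' sa' sE] [b' sb' sE']]] := hM (kcomp t u) (etrans (krng_comp tu) ta).
exists t'; split; rewrite -?sab //.
have atu : ksrc a = krng (kcomp t u) by rewrite krng_comp.
have btz : ksrc b = krng (kcomp t' z) by rewrite krng_comp // -sab.
rewrite tuE in sE' sb'.
have at' : ksrc a = krng t by [].
have bt' : ksrc b = krng t' by rewrite -sab.
have ua' : ksrc u = krng a' by rewrite -sa' !ksrc_comp.
have zb' : ksrc z = krng b' by rewrite -sb' !ksrc_comp.
have e : kcomp (kcomp a t) (kcomp u a') = kcomp (kcomp b t') (kcomp z b').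
  rewrite !kcompA ?ksrc_comp // -(kcompA at' tu) -(kcompA bt' tz) -sE sE'.
  by [].
have [] := kcomp_inj _ _ _ e => //; rewrite ?ksrc_comp ?krng_comp //.
by rewrite !kdeg_comp // dt dt' degmax_subl degmax_subr.
Qed.

(** In an aperiodic graph, a path whose range emits at most one path of each
    degree is determined by its range and source: a minimal common extension of
    prolongations [kcomp a t] and [kcomp b t] is provided by the path of the
    appropriate degree with range [v]. *)
Lemma aperiodic_range_unique (hns : no_sources L) (ap : aperiodic L) v a b :
  (forall a b, krng a = v -> krng b = v -> kdeg a = kdeg b -> a = b) ->
  krng a = v -> krng b = v -> ksrc a = ksrc b -> a = b.
Proof.
move=> uv ra rb sab; apply: contrapT => nab.
have [t rt M0] := ap _ _ nab sab.
have ra' : krng (kcomp a t) = v by rewrite krng_comp.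
have rb' : krng (kcomp b t) = v by rewrite krng_comp -?sab.
have [l [rl dl]] := hns v (degmax (kdeg (kcomp a t)) (kdeg (kcomp b t))).
suff : MCE (kcomp a t) (kcomp b t) l by rewrite M0.
have seg c m : krng c = v -> kdeg l = kdeg c + m -> segment l 0 (kdeg c) c.
  move=> rc /kfactor_ex[c' [d [cd lE dc _]]]; apply/segment0P.
  suff <- : c' = c by exists d.
  by apply: uv => //; rewrite -rl lE krng_comp.
split=> //; apply: seg => //; rewrite dl.
  exact: (esym (degmax_subl _ _)).
exact: (esym (degmax_subr _ _)).
Qed.

(** Duplicate-free enumeration of the paths of degree [n] with range [v]; it is
    empty by default if there are infinitely many of them. *)
Definition path_enum v n : seq (kpath L) := fset_set (paths_from v n).

Lemma path_enum_uniq v n : uniq (path_enum v n).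
Proof. exact: fset_uniq. Qed.

Variable hfin : row_finite L.

Lemma mem_path_enum v n a :
  reflect (krng a = v /\ kdeg a = n) (a \in path_enum v n).
Proof. by apply: (iffP idP); rewrite in_fset_set // in_setE. Qed.

(** Summing over the paths of degree [m + n] by factoring them. *)
Lemma sum_path_enumD (M : nmodType) (F : kpath L -> M) v m n :
  \sum_(l <- path_enum v (m + n)) F l =
  \sum_(a <- path_enum v m) \sum_(b <- path_enum (ksrc a) n) F (kcomp a b).
Proof.
rewrite -big_allpairs_dep; apply: perm_big; apply: uniq_perm.
- exact: path_enum_uniq.
- apply: allpairs_uniq_dep => [|a _|]; [exact: path_enum_uniq..|].
  move=> x y /allpairsPdep[a [b [/mem_path_enum[ra da] /mem_path_enum[rb db] ->]]].
  move=> /allpairsPdep[c [d [/mem_path_enum[rc dc] /mem_path_enum[rd dd] ->]]] /=.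
  have dac : kdeg a = kdeg c by rewrite da dc.
  by move=> /(kcomp_inj (esym rb) (esym rd) dac)[-> ->].
- move=> l; apply/mem_path_enum/allpairsPdep.
    move=> [rl /kfactor_ex[a [b [ab lE da db]]]]; exists a, b; split=> //.
      by apply/mem_path_enum; rewrite -rl lE krng_comp.
    by apply/mem_path_enum.
  move=> [a [b [/mem_path_enum[ra da] /mem_path_enum[rb db] ->]]].
  by rewrite krng_comp // kdeg_comp // da db.
Qed.

Lemma path_enum0 v : path_enum v 0 = [:: kid v].
Proof.
apply: perm_small_eq => //; apply: uniq_perm; rewrite ?path_enum_uniq //.
move=> a; rewrite inE; apply/mem_path_enum/eqP=> [[<- /kdeg0_id]//|->].
by rewrite krng_id kdeg_id.
Qed.

End Paths.

(** * Free commutative monoids *)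

Section FreeMonoids.
Variable K : choiceType.
Implicit Types (F G : {mset K}) (s : seq K).

Lemma sum_mset1E s y : (\sum_(x <- s) [mset x] : {mset K}) y = count_mem y s.
Proof.
elim: s => [|x s IH]; first by rewrite big_nil mset0E.
by rewrite big_cons mset_addE IH msetnE eq_sym /=; case: eqP.
Qed.

Lemma mset_sum1 F : F = \sum_(x <- F) [mset x].
Proof. by apply/msetP=> y; rewrite sum_mset1E count_mem_mset. Qed.

Lemma mset_ind (P : {mset K} -> Prop) :
  P 0 -> (forall x F, P F -> P ([mset x] + F)) -> forall F, P F.
Proof.
move=> P0 PD F; rewrite [F]mset_sum1.
by elim: (F : seq K) => [|x s IH]; rewrite ?big_nil ?big_cons //; exact: PD.
Qed.

Lemma mset_perm_add F G : perm_eq (F + G : {mset K}) (F ++ G).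
Proof. by apply/allP=> x _ /=; rewrite count_cat !count_mem_mset mset_addE. Qed.

Lemma mem_mset_add F G x : (x \in F + G) = (x \in F) || (x \in G).
Proof. by rewrite !in_mset mset_addE addn_gt0. Qed.

Lemma mem_mset1 x y : (x \in ([mset y] : {mset K})) = (x == y).
Proof. by rewrite in_mset msetnE; case: eqP. Qed.

Lemma mem_mset0 x : (x \in (0 : {mset K})) = false.
Proof. by rewrite in_mset mset0E. Qed.

End FreeMonoids.

(** * The talented monoid *)

Section Talented.
Variables (k : nat) (L : kgraph k).
Hypotheses (hfin : row_finite L) (hns : no_sources L).
Local Notation T := (talented L).
Local Notation free := {mset talented_symbol L}.
Implicit Types (v w : kvertex L) (N : 'rV[int]_k) (F G : free) (H : set (kvertex L)).

Lemma talented_eqP F G :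
  \pi_T F = \pi_T G :> T <-> talented_congruence L F G.
Proof. exact: mquot_eqP. Qed.

Lemma pi_talentedD F G : \pi_T (F + G) = \pi_T F + \pi_T G :> T.
Proof. exact: mquot_piD. Qed.

Lemma talented_action_pi N F :
  talented_action L N (\pi_T F) = \pi_T (free_action L N F) :> T.
Proof. exact: (mquot_actE (@free_action_cong _ L)). Qed.

Lemma pi_talented_sum (I : Type) (s : seq I) (E : I -> free) :
  \pi_T (\sum_(i <- s) E i) = \sum_(i <- s) \pi_T (E i) :> T.
Proof. by apply: (big_morph _ pi_talentedD); exact: mquot_pi0. Qed.

Lemma talented_relE v N i :
  \sum_(a \in paths_from v (delta_mx 0 i)) symbol (ksrc a) (N + delta_mx 0 i) =
  \sum_(a <- path_enum v (delta_mx 0 i)) symbol (ksrc a) (N + delta_mx 0 i).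
Proof. by rewrite fsbig_finite. Qed.

(** The defining relations of the talented monoid, with the degree of a single
    edge replaced by an arbitrary degree. *)
Lemma talented_gen_expand v N m :
  talented_gen v N = \sum_(a <- path_enum v m) talented_gen (ksrc a) (N + degz m).
Proof.
move: m v N; apply: degree_ind => [v N|m n IHm IHn v N|i v N].
- by rewrite path_enum0 // big_seq1 ksrc_id degz0 addr0.
- rewrite sum_path_enumD // (IHm v N).
  rewrite big_seq [RHS]big_seq; apply: eq_bigr => a _.
  rewrite (IHn (ksrc a)) big_seq [RHS]big_seq.
  apply: eq_bigr => b /mem_path_enum[] // rb _.
  by rewrite ksrc_comp // degzD addrA.
- rewrite degz_delta -pi_talented_sum; apply/talented_eqP.
  by rewrite -talented_relE; apply: GenRel; constructor; exact: hns.
Qed.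

(** ** Order ideals from hereditary saturated sets *)

(** All the symbols of [F] are over vertices of [H]. *)
Definition supported H F : Prop := forall x, x \in F -> H x.1.

Lemma supportedD H F G : supported H (F + G) <-> supported H F /\ supported H G.
Proof.
split=> [FG|[HF HG] x]; last by rewrite mem_mset_add => /orP[/HF|/HG].
by split=> x xF; apply: FG; rewrite mem_mset_add xF ?orbT.
Qed.

Lemma supported_symbol H v N : supported H (symbol v N) <-> H v.
Proof.
split=> [|Hv x]; last by rewrite mem_mset1 => /eqP ->.
by move/(_ (v, N)); apply; rewrite mem_mset1 eqxx.
Qed.

Lemma supported0 H : supported H 0.
Proof. by move=> x; rewrite mem_mset0. Qed.

Lemma supported_sum (I : eqType) H (s : seq I) (E : I -> free) :
  supported H (\sum_(i <- s) E i) <-> forall i, i \in s -> supported H (E i).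
Proof.
elim: s => [|i s IH]; first by rewrite big_nil; split=> // _; exact: supported0.
rewrite big_cons supportedD IH; split=> [[Hi Hs] j|Hs].
  by rewrite inE => /predU1P[->|/Hs].
by split=> [|j js]; apply: Hs; rewrite inE ?eqxx ?js ?orbT.
Qed.

(** Being supported in a hereditary saturated set depends only on the class in
    the talented monoid: the defining relations replace a vertex by the sources
    of the paths of some degree, and such a set contains the one if and only if
    it contains all of those sources. *)
Lemma supported_cong H F G : hereditary H -> saturated H ->
  talented_congruence L F G -> supported H F <-> supported H G.
Proof.
move=> hH sH; elim=> {F G} [_ _ [v n i hv]|F|F G _ IH|F G E _ FG _ GE|F F' G G' _ IHF _ IHG].
- rewrite talented_relE supported_symbol supported_sum; split=> [Hv a|Hs].
    move=> /mem_path_enum[] // ra _; apply/supported_symbol.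
    by apply: hH; rewrite ra.
  apply: (sH v (delta_mx 0 i)) => _ [a va <-].
  by apply/(supported_symbol H _ (n + delta_mx 0 i))/Hs/mem_path_enum.
- by [].
- by rewrite IH.
- by rewrite FG.
- by rewrite !supportedD IHF IHG.
Qed.

(** The elements of the talented monoid that are sums of symbols over vertices
    of [H]. By [supported_cong] the representative does not matter when [H] is
    hereditary and saturated. *)
Definition vertex_ideal H : set T := [set x | supported H (repr x)]%classic.

Lemma vertex_ideal_pi H F : hereditary H -> saturated H ->
  vertex_ideal H (\pi_T F) <-> supported H F.
Proof. by move=> hH sH; apply: supported_cong => //; exact: mquot_repr. Qed.

Lemma vertex_idealD H (x y : T) : hereditary H -> saturated H ->
  vertex_ideal H (x + y) <-> vertex_ideal H x /\ vertex_ideal H y.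
Proof.
move=> hH sH; elim/quotW: x => F; elim/quotW: y => G.
by rewrite -pi_talentedD !vertex_ideal_pi // supportedD.
Qed.

Lemma vertex_ideal_gen H v N : hereditary H -> saturated H ->
  vertex_ideal H (talented_gen v N) <-> H v.
Proof. by move=> hH sH; rewrite vertex_ideal_pi // supported_symbol. Qed.

Lemma vertex_idealP H : hereditary H -> saturated H ->
  zorder_ideal (talented_action L) (vertex_ideal H).
Proof.
move=> hH sH; split.
- by rewrite -mquot_pi0 vertex_ideal_pi //; exact: supported0.
- by move=> x y Hx Hy; apply/vertex_idealD.
- move=> n; elim/quotW=> F; rewrite vertex_ideal_pi // => HF.
  rewrite talented_action_pi vertex_ideal_pi //.
  move=> x; rewrite in_mset mset_seqE -has_count has_map.
  case/hasP=> y yF /eqP <- /=; apply: HF.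
  by rewrite in_mset -count_mem_mset -has_count has_pred1.
- by move=> x y [z ->] /vertex_idealD[].
Qed.

Lemma set0_hereditary : @hereditary _ L set0.
Proof. by []. Qed.

Lemma set0_saturated : @saturated _ L set0.
Proof. by move=> v n Hs; have [a va] := hns v n; apply: (Hs (ksrc a)); exists a. Qed.

(** The talented monoid of a graph without sources is conical. *)
Lemma talented_unit (x : T) : munit x -> x = 0.
Proof.
have I := vertex_idealP set0_hereditary set0_saturated.
move=> /(ideal_le I)/(_ (ideal_zero I)) Hx; rewrite -[x]reprK.
have -> : repr x = 0; last by [].
apply/msetP=> y; rewrite mset0E; apply/eqP.
by rewrite -leqn0 leqNgt -in_mset; apply/negP=> /Hx.
Qed.

Lemma talented_gen_neq0 v N : talented_gen v N <> 0.
Proof.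
have [hH sH] := (set0_hereditary, set0_saturated).
move=> v0; have := ideal_zero (vertex_idealP hH sH).
by rewrite -v0 vertex_ideal_gen.
Qed.

(** ** The talented monoid as a direct limit of free monoids *)

(** The element [F] rewritten in terms of the symbols at level [N]. The value
    is only meaningful if every symbol in [F] has level at most [N]. *)
Definition push N F : free :=
  \sum_(x <- F) \sum_(a <- path_enum x.1 (absd (N - x.2))) symbol (ksrc a) N.

Lemma pushD N F G : push N (F + G) = push N F + push N G.
Proof. by rewrite /push (perm_big _ (mset_perm_add F G)) big_cat. Qed.

Lemma push0 N : push N 0 = 0.
Proof. by rewrite /push enum_mset0 big_nil. Qed.

Lemma push_symbol N v n :
  push N (symbol v n) =
  \sum_(a <- path_enum v (absd (N - n))) symbol (ksrc a) N.
Proof. by rewrite /push enum_msetn big_seq1. Qed.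

Lemma push_symbol_ge v n p :
  push (n + degz p) (symbol v n) =
  \sum_(a <- path_enum v p) symbol (ksrc a) (n + degz p).
Proof. by rewrite push_symbol addrC addKr degzK. Qed.

Lemma push_sum (I : Type) (s : seq I) (E : I -> free) N :
  push N (\sum_(i <- s) E i) = \sum_(i <- s) push N (E i).
Proof. by apply: (big_morph _ (pushD N)); exact: push0. Qed.

(** Equal elements of the talented monoid become equal multisets at all high
    enough levels. *)
Lemma push_cong F G : talented_congruence L F G ->
  eventually (fun N => push N F = push N G).
Proof.
elim=> {F G} [_ _ [v n i hv]|F|F G _|F G E _ FG _ GE|F F' G G' _ IHF _ IHG].
- rewrite talented_relE; exists (n + delta_mx 0 i) => p.
  rewrite push_sum -degz_delta -addrA -degzD push_symbol_ge sum_path_enumD //.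
  rewrite big_seq [RHS]big_seq; apply: eq_bigr => a _.
  rewrite degzD addrA push_symbol_ge big_seq [RHS]big_seq.
  by apply: eq_bigr => b /mem_path_enum[] // rb _; rewrite ksrc_comp.
- exact: eventuallyT.
- exact: eventually_imp.
- apply: (eventually_imp _ (eventually_and FG GE)) => N.
  by move=> [] ->.
- apply: (eventually_imp _ (eventually_and IHF IHG)) => N [eF eG].
  by rewrite !pushD eF eG.
Qed.

(** Passing to a high level does not change the class. *)
Lemma push_pi F : eventually (fun N => \pi_T (push N F) = \pi_T F :> T).
Proof.
elim/mset_ind: F => [|[v n] F IH]; first by apply: eventuallyT => N; rewrite push0.
apply: (eventually_imp _ (eventually_and IH (eventually_ge n))).
move=> N [IHN [p NE]]; rewrite pushD !pi_talentedD IHN; congr (_ + _).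
rewrite NE push_symbol_ge pi_talented_sum.
exact/esym/talented_gen_expand.
Qed.


(** ** Atoms of the talented monoid *)

Lemma atom_gen (x : T) : matom x -> exists v N, x = talented_gen v N.
Proof.
elim/quotW: x => F; elim/mset_ind: F => [|[v N] F _] [nu at_x].
  by case: nu; exists 0; rewrite addr0.
move: at_x; rewrite pi_talentedD => /(_ _ _ erefl)[/talented_unit|/talented_unit->].
  by move/talented_gen_neq0.
by exists v, N; rewrite addr0.
Qed.

(** If a vertex emitted two paths of degree [p], then [talented_gen v N] would
    be a sum of two nonzero elements. *)
Lemma atom_path_enum v N p :
  matom (talented_gen v N) -> exists a, path_enum v p = [:: a].
Proof.
move=> [_]; rewrite (talented_gen_expand v N p).
have [a] := hns v p; move/mem_path_enum => /(_ hfin).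
case: (path_enum v p) => [|b [|c s]] // _; first by exists b.
rewrite big_cons => /(_ _ _ erefl)[/talented_unit/talented_gen_neq0//|].
rewrite big_cons => -[z]; rewrite -addrA => /esym c0.
have /talented_unit/talented_gen_neq0[] : munit (talented_gen (ksrc c) (N + degz p)).
by eexists; symmetry; exact: c0.
Qed.

(** Atoms are prime: at a high enough level an atom is a single symbol, and the
    relation becomes one between elements of a free commutative monoid. *)
Lemma atom_prime (x y z : T) : matom x -> mle x (y + z) -> mle x y \/ mle x z.
Proof.
move=> atx; have [v [n xE]] := atom_gen atx; rewrite {}xE in atx *.
elim/quotW: y => F; elim/quotW: z => G [c]; elim/quotW: c => C.
rewrite -!pi_talentedD => /talented_eqP/push_cong e.
have [N [[[FN GN] eN] [p NE]]] := eventually_ex (eventually_and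
  (eventually_and (eventually_and (push_pi F) (push_pi G)) e) (eventually_ge n)).
have [a pa] := atom_path_enum p atx.
have xE : talented_gen v n = talented_gen (ksrc a) N.
  by rewrite (talented_gen_expand v n p) pa big_seq1 NE.
have le E : (ksrc a, N) \in push N E -> mle (talented_gen (ksrc a) N) (\pi_T (push N E)).
  move=> aE; rewrite [X in \pi_T X]mset_sum1 pi_talented_sum.
  rewrite (big_rem (ksrc a, N)); last first.
    by move: aE; rewrite in_mset -count_mem_mset -has_count has_pred1.
  by eexists.
have : (ksrc a, N) \in push N F + push N G.
  by rewrite -pushD eN pushD NE push_symbol_ge pa big_seq1 mem_mset_add mem_mset1 eqxx.
by rewrite xE -FN -GN mem_mset_add => /orP[/le|/le]; [left|right].
Qed.

Lemma atom_prime_sum (x : T) (I : eqType) (s : seq I) (E : I -> T) : matom x ->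
  mle x (\sum_(i <- s) E i) -> exists2 i, i \in s & mle x (E i).
Proof.
move=> atx; elim: s => [|i s IH]; first by rewrite big_nil; case: atx.
rewrite big_cons => /atom_prime[]// => [xi|/IH[j js xj]].
  by exists i; rewrite ?mem_head.
by exists j; rewrite // inE js orbT.
Qed.

End Talented.

(** * Quotients by order ideals *)

Section IdealQuotients.
Variables (k : nat) (M : nmodType) (A : zaction k M) (I : set M).
Hypothesis hI : zorder_ideal A I.
Local Notation Q := (ideal_quotient hI).

Lemma ideal_quotient_eq0 x : \pi_Q x = 0 :> Q <-> I x.
Proof.
rewrite -mquot_pi0; split=> [/mquot_eqP[a [b [_ Ib]]]|Ix].
  by rewrite add0r => xab; apply: (ideal_le hI) Ib; exists a.
apply/mquot_eqP; exists 0, x.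
by split; [exact: ideal_zero hI|exact: Ix|exact: addrC].
Qed.

Lemma ideal_quotient_actE n x :
  ideal_quotient_action hI n (\pi_Q x) = \pi_Q (A n x).
Proof. exact: (mquot_actE (@ideal_cong_act _ _ _ _ hI)). Qed.

End IdealQuotients.

(** * Free actions imply strong aperiodicity *)

Section FreeAperiodic.
Variables (k : nat) (L : kgraph k) (H : set (kvertex L)).
Hypotheses (hfin : row_finite L) (hns : no_sources L).
Hypotheses (hH : hereditary H) (sH : saturated H).
Local Notation G := (quotient_graph hH).
Local Notation T := (talented L).

Lemma quotient_no_sources : no_sources G.
Proof.
move=> v n; apply: contrapT => vn.
have := valP v; rewrite notin_setE; apply.
apply: (sH (n := n)) => _ [a [ra da] <-]; apply: contrapT => aH.
have {}aH : ksrc a \notin H by rewrite notin_setE.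
by apply: vn; exists (Sub a aH : qpath H); split=> //; exact: val_inj.
Qed.

(** The paths in [G] of degree [degmax (kdeg a) (kdeg b)] that extend [a]. *)
Definition extensions (a b : kpath G) : seq (kpath L) :=
  [seq kcomp (val a) t | t <- path_enum (ksrc (val a))
    (degsub (degmax (kdeg a) (kdeg b)) (kdeg a)) & ksrc t \notin H].

Lemma extensions_uniq a b : uniq (extensions a b).
Proof.
rewrite map_inj_in_uniq ?filter_uniq ?path_enum_uniq // => t t'.
rewrite !mem_filter => /andP[_ /mem_path_enum[]//rt dt].
move=> /andP[_ /mem_path_enum[]//rt' dt'] e.
by have [] := kcomp_inj (esym rt) (esym rt') erefl e.
Qed.

Lemma extensions_sub (a b : kpath G) : ksrc a = ksrc b ->
  (forall t, krng t = ksrc a -> (MCE (kcomp a t) (kcomp b t) !=set0)%classic) ->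
  {subset extensions a b <= extensions b a}.
Proof.
move=> sab hM _ /mapP[t + ->]; rewrite mem_filter => /andP[tH /mem_path_enum[]// rt dt].
pose t' : kpath G := Sub t tH : qpath H.
have rt' : krng t' = ksrc a by apply: val_inj.
have [u [ru du e]] := MCE_swap quotient_no_sources sab hM rt' dt.
apply/mapP; exists (val u).
  rewrite mem_filter (valP u); apply/mem_path_enum => //.
  by split; [exact: (congr1 val ru)|rewrite degmaxC].
by have := congr1 val e; rewrite !val_qcomp.
Qed.

(** Modulo the ideal of [H], the generator at the source of [a] and at the level
    of [a] is the sum of the generators at the sources of its extensions. *)
Lemma gen_extensions (a b : kpath G) : exists2 r,
  vertex_ideal H r &
  talented_gen (ksrc (val a)) (degz (kdeg a)) =
  \sum_(l <- extensions a b)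
     talented_gen (ksrc l) (degz (degmax (kdeg a) (kdeg b))) + r :> T.
Proof.
set N := degmax _ _.
rewrite (talented_gen_expand hfin hns _ _ (degsub N (kdeg a))).
rewrite (bigID (fun t => ksrc t \notin H)) /= -degzD degmax_subl -/N.
rewrite /extensions big_map big_filter -/N; eexists; last first.
  congr (_ + _).
  rewrite big_seq_cond [RHS]big_seq_cond; apply: eq_bigr => t /andP[].
  by move=> /mem_path_enum[]// rt _ _; rewrite ksrc_comp.
have I := vertex_idealP hfin hH sH.
apply: big_ind; [exact: ideal_zero I|exact: ideal_add I|].
by move=> t; rewrite negbK in_setE => tH; apply/vertex_ideal_gen.
Qed.

Lemma free_aperiodic :
  (forall (I : set T) (hI : zorder_ideal (talented_action L) I),
       acts_freely (ideal_quotient_action hI)) ->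
  aperiodic G.
Proof.
pose hI := vertex_idealP hfin hH sH.
move=> /(_ _ hI) fr a b ab sab; apply: contrapT => nM.
have hM t : krng t = ksrc a -> (MCE (kcomp a t) (kcomp b t) !=set0)%classic.
  by move=> rt; apply: contrapT => /set0P/negP; rewrite negbK => /eqP M0; apply: nM; exists t.
have hM' t : krng t = ksrc b -> (MCE (kcomp b t) (kcomp a t) !=set0)%classic.
  by rewrite -sab => /hM[s]; exists s; exact: MCE_sym.
have ext : perm_eq (extensions a b) (extensions b a).
  apply: uniq_perm; rewrite ?extensions_uniq // => l.
  by apply/idP/idP; apply: extensions_sub.
set w := ksrc (val a); have wb : w = ksrc (val b) by exact: (congr1 val sab).
have e : ideal_cong (vertex_ideal H)
    (talented_gen w (degz (kdeg a))) (talented_gen w (degz (kdeg b))).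
  have [r Ir rE] := gen_extensions a b; have [r' Ir' rE'] := gen_extensions b a.
  exists r', r; split=> //; rewrite {2}wb [LHS]addrC rE rE' (perm_big _ ext) /=.
  by rewrite (degmaxC (kdeg b)) addrCA addrA.
have bH : ~ H (ksrc (val b)) by have := valP b; rewrite notin_setE.
pose y : ideal_quotient hI := \pi_(ideal_quotient hI) (talented_gen w (degz (kdeg b))).
have y0 : y != 0.
  by apply/eqP=> /ideal_quotient_eq0/vertex_ideal_gen; rewrite wb => /(_ hfin hH sH).
have n0 : degz (kdeg a) - degz (kdeg b) != 0.
  rewrite subr_eq0; apply/eqP=> /(can_inj (@degzK k)) dab; apply: ab.
  have [t /MCE_eq] := hM (kid (ksrc a)) (krng_id _).
  by rewrite kcomp_idr sab kcomp_idr => /(_ dab).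
have /eqP[] := fr _ _ y0 n0.
rewrite ideal_quotient_actE talented_action_gen addrC subrK.
by apply/mquot_eqP.
Qed.

End FreeAperiodic.

(** * Strong aperiodicity implies free actions *)

Section AperiodicFree.
Variables (k : nat) (L : kgraph k).
Hypotheses (hfin : row_finite L) (hns : no_sources L).
Local Notation T := (talented L).
Local Notation act := (talented_action L).

(** A translate of an atom that equals the atom yields, after passing to a
    common level, two paths of different degrees with equal range and source. *)
Lemma atom_period v N n : matom (talented_gen v N : T) -> n != 0 ->
  talented_gen v (N + n) = talented_gen v N :> T ->
  exists a b : kpath L,
    [/\ a <> b, krng a = v, krng b = v & ksrc a = ksrc b].
Proof.
move=> at_v n0 /talented_eqP/(push_cong hfin) e.
have [N' [[eN' [p pE]] [q qE]]] := eventually_ex (eventually_and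
  (eventually_and e (eventually_ge N)) (eventually_ge (N + n))).
have [a pa] := atom_path_enum hfin hns p at_v.
have [b qb] := atom_path_enum hfin hns q at_v.
have [ra da] : krng a = v /\ kdeg a = p by apply/mem_path_enum; rewrite ?pa ?mem_head.
have [rb db] : krng b = v /\ kdeg b = q by apply/mem_path_enum; rewrite ?qb ?mem_head.
exists a, b; split=> //.
  move=> ab; move: qE; rewrite pE -da -db ab addrAC -[LHS]addr0 => /addrI n0'.
  by move: n0; rewrite -n0' eqxx.
have pushN : push N' (symbol v N) = symbol (ksrc a) N'.
  by rewrite pE push_symbol_ge pa big_seq1.
have pushNn : push N' (symbol v (N + n)) = symbol (ksrc b) N'.
  by rewrite qE push_symbol_ge qb big_seq1.
move: eN'; rewrite pushN pushNn => /msetP/(_ (ksrc a, N')).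
by rewrite msetnxx msetnE; case: eqP => // -[].
Qed.

(** An injective map that preserves a finite set is periodic on it. *)
Lemma iter_periodic (X : eqType) (f : X -> X) (s : seq X) (x : X) :
  injective f -> {in s, forall y, f y \in s} -> x \in s ->
  exists2 j, (0 < j)%N & iter j f x = x.
Proof.
move=> finj fs xs.
have iter_s j : iter j f x \in s by elim: j => //= j; exact: fs.
have sub : {subset traject f x (size s).+1 <= s} by move=> _ /trajectP[j _ ->].
have : looping f x (size s).
  rewrite -[looping _ _ _]negbK -looping_uniq; apply/negP=> /uniq_leq_size/(_ sub).
  by rewrite size_traject ltnn.
move=> /loopingP/(_ (size s))/trajectP[i lt_i e].
exists (size s - i)%N; first by rewrite subn_gt0.
have iter_inj : injective (iter i f) by elim: i {lt_i e} => //= i IH y z /finj/IH.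
by apply: iter_inj; rewrite -iterD subnKC // ltnW.
Qed.

Lemma iter_zact (M : nmodType) (A : zaction k M) n j x :
  iter j (A n) x = A (n *+ j) x.
Proof.
elim: j => [|j IH] /=; first by rewrite mulr0n zact0.
by rewrite IH mulrS zactD.
Qed.

Lemma zactK (M : nmodType) (A : zaction k M) n : cancel (A n) (A (- n)).
Proof. by move=> x; rewrite -zactD addNr zact0. Qed.

Lemma zactNK (M : nmodType) (A : zaction k M) n : cancel (A (- n)) (A n).
Proof. by move=> x; rewrite -zactD subrr zact0. Qed.

Section Ideal.
Variable I : set T.
Hypothesis hI : zorder_ideal act I.

(** The vertices whose symbols lie in [I]; by [ideal_verticesP] the level is
    irrelevant. *)
Definition ideal_vertices : set (kvertex L) := [set v | I (talented_gen v 0)]%classic.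

Lemma ideal_verticesP v N : ideal_vertices v <-> I (talented_gen v N).
Proof.
split=> [/(ideal_act hI N)|/(ideal_act hI (- N))];
  by rewrite talented_action_gen ?add0r ?subrr.
Qed.

Lemma ideal_vertices_hereditary : hereditary ideal_vertices.
Proof.
move=> l Il; apply/(ideal_verticesP _ (degz (kdeg l))).
apply: (ideal_le hI) Il; rewrite (talented_gen_expand hfin hns (krng l) 0 (kdeg l)).
rewrite add0r (big_rem l); last exact/mem_path_enum.
by eexists.
Qed.

Lemma ideal_vertices_saturated : saturated ideal_vertices.
Proof.
move=> v n Hv; rewrite /ideal_vertices /= (talented_gen_expand hfin hns v 0 n).
rewrite big_seq; apply: big_ind; [exact: ideal_zero hI|exact: ideal_add hI|].
move=> a /mem_path_enum[]// ra da; apply/ideal_verticesP.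
by apply: Hv; exists a.
Qed.

(** An atom outside the ideal, fixed by a nonzero degree, contradicts the
    aperiodicity of the graph with the vertices of the ideal removed. *)
Lemma atom_outside_not_periodic x n : strongly_aperiodic L ->
  matom x -> ~ I x -> n != 0 -> act n x != x.
Proof.
move=> sap atx nIx n0; apply/eqP.
have [v [N xE]] := atom_gen hfin hns atx; rewrite {}xE in atx nIx *.
rewrite talented_action_gen => /(atom_period atx n0)[a [b [ab ra rb sab]]].
have hH := ideal_vertices_hereditary.
have Hv : v \notin ideal_vertices.
  by rewrite notin_setE => /ideal_verticesP.
have Ha c : krng c = v -> ksrc c \notin ideal_vertices.
  move=> rc; rewrite notin_setE => /(ideal_verticesP _ (N + degz (kdeg c))) Ic.
  apply: nIx; rewrite (talented_gen_expand hfin hns v N (kdeg c)).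
  have [c' vc'] := atom_path_enum hfin hns (kdeg c) atx.
  have : c \in path_enum v (kdeg c) by apply/mem_path_enum.
  by rewrite vc' big_seq1 inE => /eqP <-.
have ap : aperiodic (quotient_graph hH).
  apply: sap; first exact: ideal_vertices_saturated.
  by move=> HT; move: Hv; rewrite HT notin_setE; apply.
pose v' : kvertex (quotient_graph hH) := Sub v Hv : qvertex ideal_vertices.
pose a' : kpath (quotient_graph hH) := Sub a (Ha a ra) : qpath ideal_vertices.
pose b' : kpath (quotient_graph hH) := Sub b (Ha b rb) : qpath ideal_vertices.
have nsG : no_sources (quotient_graph hH).
  by apply: quotient_no_sources => //; exact: ideal_vertices_saturated.
apply: ab; suff: a' = b' by move/(congr1 val).
apply: (aperiodic_range_unique nsG ap (v := v')); try exact: val_inj.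
move=> c d rc rd dcd; apply: val_inj.
have [u vu] := atom_path_enum hfin hns (kdeg c) atx.
have : val c \in path_enum v (kdeg c).
  by apply/mem_path_enum => //; split=> //; exact: (congr1 val rc).
have : val d \in path_enum v (kdeg c).
  by apply/mem_path_enum => //; split; rewrite ?dcd //; exact: (congr1 val rd).
by rewrite vu !inE => /eqP -> /eqP ->.
Qed.

Lemma aperiodic_free : atomic T -> strongly_aperiodic L ->
  acts_freely (ideal_quotient_action hI).
Proof.
move=> atT sap; elim/quotW=> x n /eqP x0 n0; apply/eqP.
rewrite ideal_quotient_actE => /mquot_eqP[i [j [Ii Ij e]]].
have nIx : ~ I x by move=> Ix; apply: x0; apply/ideal_quotient_eq0.
have [s at_s xE] : exists2 s : seq T, (forall y, y \in s -> matom y) & x = \sum_(y <- s) y.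
  by apply: atT => /(ideal_le hI)/(_ (ideal_zero hI)).
(* The summands outside [I], which [act (- n)] permutes. *)
pose s' := [seq y <- s | `[< ~ I y >]].
have mem_s' y : y \in s' <-> y \in s /\ ~ I y.
  rewrite mem_filter; split=> [/andP[/asboolP]//|[ys /asboolP ->]//].
have [b bs'] : exists b, b \in s'.
  apply: contrapT => s'0; apply: nIx; rewrite xE big_seq.
  apply: big_ind; [exact: ideal_zero hI|exact: ideal_add hI|].
  by move=> y ys; apply: contrapT => nIy; apply: s'0; exists y; apply/mem_s'.
have s'_act y : y \in s' -> act (- n) y \in s'.
  move=> /mem_s'[ys nIy]; apply/mem_s'; split; last first.
    by move=> /(ideal_act hI n); rewrite zactNK.
  (* [y] lies below [act n x + i] and is prime, so it lies below the translate of
     some summand [z]; as [z] is an atom too, [z] is [act (- n) y]. *)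
  have : mle y (act n x + i).
    by rewrite e xE (big_rem y) //= -addrA; eexists.
  move=> /(atom_prime hfin hns (at_s _ ys))[|/(ideal_le hI)/(_ Ii)//].
  rewrite xE (big_morph _ (zact_add act n) (zact_zero act n)).
  move=> /(atom_prime_sum hfin hns (at_s _ ys))[z zs [c /(congr1 (act (- n)))]].
  rewrite zactK zact_add => zE.
  case: (proj2 (at_s _ zs) _ _ zE) => /(talented_unit hfin hns) u0; last first.
    by rewrite -(addr0 (act (- n) y)) -u0 -zE.
  have /(congr1 (act n)) := u0; rewrite zactNK zact_zero => y0.
  by case: nIy; rewrite y0; exact: ideal_zero hI.
have [p p_gt0] := iter_periodic (can_inj (zactNK act n)) s'_act bs'.
rewrite iter_zact => /eqP; apply/negP.
move/mem_s': bs' => [bs nIb]; apply: atom_outside_not_periodic => //.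
  exact: at_s.
apply: contra n0 => /eqP/rowP np0; apply/eqP/rowP=> l.
have /eqP := np0 l; rewrite mulmxnE !mxE.
by rewrite Num.Theory.mulrn_eq0 oppr_eq0 eqn0Ngt p_gt0 => /eqP.
Qed.

End Ideal.
End AperiodicFree.

Theorem theorem5p11 (k : nat) (hk : (0 < k)%N) (L : kgraph k)
    (hfin : row_finite L) (hns : no_sources L) :
  ((forall (I : set (talented L)) (hI : zorder_ideal (talented_action L) I),
       acts_freely (ideal_quotient_action hI)) ->
     strongly_aperiodic L)
  /\ (atomic (talented L) ->
      strongly_aperiodic L ->
      forall (I : set (talented L)) (hI : zorder_ideal (talented_action L) I),
        acts_freely (ideal_quotient_action hI)).
Proof.
split=> [fr H hH sH _|atT sap I hI]; first exact: free_aperiodic.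
exact: aperiodic_free.
Qed.
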